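(* Let $\mathcal{H}$ be a complex Hilbert space, let $A\in\mathbb{B}(\mathcal{H})$ be a positive operator, and let $T, S\in\mathbb{B}_{A^{1/2}}(\mathcal{H})$. Then the following conditions are equivalent: (i) There exists a sequence of $A$-unit vectors $\{x_n\}$ in $\mathcal{H}$ (i.e. $\|x_n\|_A=1$ for all $n$) such that $\lim_{n\to+\infty}\|Tx_n\|_A = \|T\|_A$ and $\lim_{n\to+\infty}\langle Tx_n, Sx_n\rangle_A = 0$. (ii) $\|T+\gamma S\|_A^2 \geq \|T\|_A^2 + |\gamma|^2 m_A^2(S)$ for all $\gamma\in\mathbb{C}$. (iii) $T\perp^B_A S$, i.e. $\|T+\gamma S\|_A \geq \|T\|_A$ for all $\gamma\in\mathbb{C}$.
   Context: $\mathbb{B}(\mathcal{H})$ denotes the bounded linear operators on the complex Hilbert space $(\mathcal{H},\langle\cdot,\cdot\rangle)$. An operator $A\in\mathbb{B}(\mathcal{H})$ is positive if $\langle Ax,x\rangle\ge 0$ for all $x\in\mathcal{H}$. Put $\langle x,y\rangle_A=\langle Ax,y\rangle$ and $\|x\|_A=\sqrt{\langle x,x\rangle_A}$ (a seminorm). $\mathbb{B}_{A^{1/2}}(\mathcal{H})$ is the set of $T\in\mathbb{B}(\mathcal{H})$ for which there is $c>0$ with $\|Tx\|_A\le c\|x\|_A$ for all $x\in\mathcal{H}$. For such $T$, $\|T\|_A=\sup\{\|Tx\|_A/\|x\|_A:\ x\in\overline{\mathcal{R}(A)},\ x\ne 0\}=\inf\{c>0:\ \|Tx\|_A\le c\|x\|_A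 \text{ for all } x\in\mathcal{H}\}$, where $\overline{\mathcal{R}(A)}$ is the norm closure of the range of $A$; also $\|T\|_A=\sup\{\|Tx\|_A:\ x\in\mathcal{H},\ \|x\|_A=1\}$. The $A$-minimum modulus of $S\in\mathbb{B}_{A^{1/2}}(\mathcal{H})$ is $m_A(S)=\inf\{\|Sx\|_A:\ x\in\mathcal{H},\ \|x\|_A=1\}$, and $m_A^2(S)=(m_A(S))^2$.
   Formalization: The operator A is assumed to be nonzero: for A = 0 there are no A-unit vectors, so (i) fails while (iii) holds trivially, and the equivalence as printed is false in that case. *)

(* Defs.v *)
From HB Require Import structures.
From mathcomp Require Import all_boot all_order all_algebra.
From mathcomp Require Import all_classical all_reals all_analysis.
From mathcomp Require Import complex.

Set Implicit Arguments.
Unset Strict Implicit.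
Unset Printing Implicit Defensive.

Import Order.TTheory GRing.Theory Num.Theory.
Import numFieldNormedType.Exports.

Local Open Scope classical_set_scope.
Local Open Scope ring_scope.
Local Open Scope complex_scope.

Section SemiHilbert.
Variables (R : realType) (H : completeNormedModType R[i]).

(* The completeness and topology of [H] come from its norm: this makes [H] a
   Hilbert space with inner product [ip], linear in its first argument. *)
Definition hilbert_inner_product (ip : {dot H for Num.conj}) : Prop :=
  forall x, `|x| ^+ 2 = ip x x.

(* For a linear map, being bounded near 0 is the same as being continuous, and
   the same as [exists M, forall x, `|T x| <= M * `|x|]: see
   [linear_bounded_continuous] and [linear_boundedP]. *)
Definition bounded_operator (T : {linear H -> H}) : Prop :=
  bounded_near T (nbhs (0 : H)).

Variable ip : {dot H for Num.conj}.

(* The order of [R[i]] makes [0 <= z] mean that [z] is real and nonnegative. *)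
Definition positive_operator (A : {linear H -> H}) : Prop :=
  forall x, 0 <= ip (A x) x.

Variable A : {linear H -> H}.

Definition ipA (x y : H) : R[i] := ip (A x) y.

(* For positive [A], [ipA x x] is real, so that no information is lost by
   taking its real part. *)
Definition normA (x : H) : R := Num.sqrt (complex.Re (ipA x x)).

(* Membership of a bounded operator in B_{A^{1/2}}(H). *)
Definition A_bounded (T : {linear H -> H}) : Prop :=
  bounded_operator T /\
  exists2 c : R, 0 < c & forall x, normA (T x) <= c * normA x.

(* [sup] and [inf] are those of [R], hence 0 on empty sets. The two sets below
   are nonempty as soon as the positive operator [A] is nonzero, and the first
   one is bounded above when [T] is [A_bounded]. *)
Definition opnormA (T : H -> H) : R :=
  sup [set normA (T x) / normA x | x in closure (range A) `\ (0 : H)].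

Definition minmodA (S : H -> H) : R :=
  inf [set normA (S x) | x in [set x | normA x = 1]].

Definition birkhoff_orthogonalA (T S : H -> H) : Prop :=
  forall g : R[i], opnormA T <= opnormA (T \+ g \*: S).

End SemiHilbert.

(* Main.v *)
Require Import Defs.
From HB Require Import structures.
From mathcomp Require Import all_boot all_order all_algebra.
From mathcomp Require Import all_classical all_reals all_analysis.
From mathcomp Require Import complex.
From mathcomp Require Import ring lra.

(* Only (iii) => (i) is not a direct computation. Write N for the A-seminorm of
   T, F(x) = <Tx, Sx>_A and p(x) = N^2 |x|_A^2 - |Tx|_A^2, a positive
   semidefinite form. Applying (iii) to small multiples of a unimodular c gives
   A-unit vectors y with p(y) small and Re (conj c F(y)) almost nonpositive.
   Let i be the infimum of the moduli |F(x)| reachable by A-unit vectors with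
   p(x) arbitrarily small. If i > 0, take such an x with |F(x)| = r close to i,
   rotate S so that F(x) = r, and take y for c = 1. As in the
   Toeplitz-Hausdorff theorem, the phase of y can be chosen so that, along
   x + s y, F stays real to first order in s and F / |.|_A^2 does not increase
   to first order; the second order term makes its modulus drop by a fixed
   amount for a fixed small s, while p stays small since it is a semidefinite
   form. This contradicts the choice of i.
   The supremum defining the seminorm of T only involves the closure of the
   range of A; it bounds |Tx|_A for all x because the range of A is dense for
   |.|_A: along the gradient descent x <- x - m^-1 A x, with m a norm bound of A, |x|^2
   drops by at least <Ax, x> / m, so <Ax, x> becomes arbitrarily small. *)

Set Implicit Arguments.
Unset Strict Implicit.
Unset Printing Implicit Defensive.

Import Order.TTheory GRing.Theory Num.Theory.
Import numFieldNormedType.Exports.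

Local Open Scope classical_set_scope.
Local Open Scope ring_scope.
Local Open Scope complex_scope.

(** * The real inequality behind the descent *)

(** Here [r] is F(x), [a] and [gi] are the real and imaginary parts of F(w), and [n] is |x + s
    w|_A^2. As [G <= r * k], the real part of F(x + s w) is at most [r * n - s ^+ 2 * r / 2], while
    its imaginary part is only of order s^2; the choice of [s] makes the square of the latter small
    against that drop. *)
Lemma quadratic_descent (R : realFieldType) (r C a gi G k : R) :
  0 < r -> r <= C -> a <= r / 2 -> `|a| <= C -> `|gi| <= C -> `|G| <= 2 * C ->
  `|k| <= 2 -> G <= r * k ->
  let s := r / (24 * C) in
  let n := 1 + s * k + s ^+ 2 in
  1 / 4 <= n /\ s <= 1 /\
  (r + s * G + s ^+ 2 * a) ^+ 2 + (s ^+ 2 * gi) ^+ 2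
    <= ((r - s ^+ 2 * r / 16) * n) ^+ 2.
Proof.
move=> r0 rC ar; rewrite !ler_norml => /andP[aC1 aC2] /andP[gC1 gC2].
move=> /andP[G1 G2] /andP[k1 k2] Gk s n.
have C0 : 0 < C by lra.
have sC : s * C = r / 24 by rewrite /s; field; rewrite gt_eqF.
have s0 : 0 < s by rewrite /s divr_gt0 // mulr_gt0.
have s1 : s <= 1 / 24.
  by rewrite /s ler_pdivrMr ?mulr_gt0 //; lra.
have n1 : 1 / 4 <= n by rewrite /n; nra.
have n4 : n <= 4 by rewrite /n; nra.
split=> //; split; first lra.
set t := s ^+ 2 * r / 2.
have t0 : 0 <= t by rewrite /t; apply: divr_ge0 => //; apply: mulr_ge0; [exact: sqr_ge0 | lra].
set D := s * (G - r * k) + s ^+ 2 * (a - r).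
have E : r + s * G + s ^+ 2 * a = r * n + D by rewrite /D /n; ring.
have D1 : D <= - t.
  have h1 : s * (G - r * k) <= 0 by nra.
  have h2 : s ^+ 2 * (a - r) <= s ^+ 2 * (- r / 2).
    by apply: ler_wpM2l; [exact: sqr_ge0 | lra].
  by rewrite /D /t; lra.
(* This keeps [r * n + D] nonnegative, so that its upper bound may be squared. *)
have D2 : - (r * n) <= D.
  have h1 : s * (- (4 * C)) <= s * (G - r * k).
    by apply: ler_wpM2l; [lra | nra].
  have h2 : s ^+ 2 * (- (2 * C)) <= s ^+ 2 * (a - r).
    by apply: ler_wpM2l; [exact: sqr_ge0 | lra].
  have h3 : s ^+ 2 * C <= s * C by rewrite ler_wpM2r //; nra.
  have h4 : r * (1 / 4) <= r * n by rewrite ler_pM2l.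
  by rewrite /D; lra.
have h5 : (r + s * G + s ^+ 2 * a) ^+ 2 <= (r * n - t) ^+ 2 by rewrite E; nra.
have h6 : (s ^+ 2 * gi) ^+ 2 <= (s * (r / 24)) ^+ 2.
  have h7 : gi ^+ 2 <= C ^+ 2 by nra.
  rewrite -sC (_ : s * (s * C) = s ^+ 2 * C); last by ring.
  rewrite [(s ^+ 2 * gi) ^+ 2]exprMn [(s ^+ 2 * C) ^+ 2]exprMn.
  by apply: ler_wpM2l => //; exact: sqr_ge0.
have h7 : (s * (r / 24)) ^+ 2 = t * (r / 288) by rewrite /t; field.
have h8 : t <= r / 1152.
  by rewrite /t; nra.
(* Half of the drop [t] absorbs the imaginary part. *)
have h9 : ((r * n - t) ^+ 2 + t * (r / 288)) <= (r * n - t / 2) ^+ 2.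
  nra.
have h10 : 0 <= r * n - t / 2 by nra.
have h11 : r * n - t / 2 <= (r - s ^+ 2 * r / 16) * n.
  have : s ^+ 2 * r / 16 * n <= t / 2.
    have -> : s ^+ 2 * r / 16 = t / 8 by rewrite /t; field.
    nra.
  by lra.
apply: (@le_trans _ _ ((r * n - t / 2) ^+ 2)); last by rewrite ler_pXn2r // ?nnegrE //; lra.
by apply: le_trans h9; rewrite -h7; exact: lerD.
Qed.

(** * Semidefinite sesquilinear forms *)

(* The real part of a positive semidefinite sesquilinear form; its imaginary
   part at [(x, y)] is then [B x ('i *: y)]. *)
Record semi_inner (R : rcfType) (V : lmodType R[i]) (B : V -> V -> R) : Prop :=
  SemiInner {
    semi_innerDl : forall x y z, B (x + y) z = B x z + B y z;
    semi_innerZl : forall a x y, B (a%:C *: x) y = a * B x y;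
    semi_innerC : forall x y, B x y = B y x;
    semi_inner_ge0 : forall x, 0 <= B x x;
    semi_innerii : forall x y, B ('i *: x) ('i *: y) = B x y
  }.

Section SemiInner.
Variables (R : rcfType) (V : lmodType R[i]) (B : V -> V -> R).
Hypothesis sB : semi_inner B.

Let BDl := semi_innerDl sB.
Let BZl := semi_innerZl sB.
Let BC := semi_innerC sB.
Let B_ge0 := semi_inner_ge0 sB.
Let Bii := semi_innerii sB.

Lemma semi_innerDr x y z : B x (y + z) = B x y + B x z.
Proof. by rewrite BC BDl !(BC x). Qed.

Lemma semi_innerZr a x y : B x (a%:C *: y) = a * B x y.
Proof. by rewrite BC BZl BC. Qed.

Lemma semi_innerNl x y : B (- x) y = - B x y.
Proof. by rewrite -scaleN1r -(rmorphN1 (real_complex R)) BZl mulN1r. Qed.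

Lemma semi_innerNr x y : B x (- y) = - B x y.
Proof. by rewrite BC semi_innerNl BC. Qed.

Lemma semi_inneril x y : B ('i *: x) y = - B x ('i *: y).
Proof. by rewrite -Bii scalerA -expr2 sqr_i scaleN1r semi_innerNl. Qed.

Lemma scale_complexE (c : R[i]) (x : V) :
  c *: x = (complex.Re c)%:C *: x + (complex.Im c)%:C *: ('i *: x).
Proof. by rewrite {1}(complexE c) scalerDl scalerA (mulrC 'i). Qed.

Lemma semi_inner_scale (c : R[i]) (x y : V) :
  B (c *: x) (c *: y) = Normc.normc c ^+ 2 * B x y.
Proof.
rewrite !(scale_complexE c) !(BDl, semi_innerDr, BZl, semi_innerZr).
rewrite Bii semi_inneril; case: c => a b /=.
by rewrite sqr_sqrtr ?addr_ge0 ?sqr_ge0 //; ring.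
Qed.

Lemma semi_inner_CS x y : B x y ^+ 2 <= B x x * B y y.
Proof.
have h t : 0 <= B x x + 2 * t * B x y + t ^+ 2 * B y y.
  have := B_ge0 (x + t%:C *: y).
  by rewrite !(BDl, semi_innerDr, BZl, semi_innerZr) (BC y x); lra.
have [y0|y0] := eqVneq (B y y) 0.
  have [->|xy] := eqVneq (B x y) 0; first by rewrite y0 mulr0 expr0n.
  (* With [B y y = 0] the polynomial in [h] is affine; at this point it would equal -1. *)
  have := h (- (B x x + 1) / (2 * B x y)); rewrite y0.
  have -> : 2 * (- (B x x + 1) / (2 * B x y)) * B x y = - (B x x + 1) by field.
  by lra.
have yp : 0 < B y y by rewrite lt_neqAle eq_sym y0 B_ge0.
have := h (- (B x y) / B y y).
rewrite -(ler_pM2r yp) mul0r.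
have -> : (B x x + 2 * (- B x y / B y y) * B x y + (- B x y / B y y) ^+ 2 * B y y)
  * B y y = B x x * B y y - B x y ^+ 2 by field.
by lra.
Qed.

Lemma semi_inner_norm_le x y (N M : R) : 0 <= N -> 0 <= M ->
  B x x <= N ^+ 2 -> B y y <= M ^+ 2 -> `|B x y| <= N * M.
Proof.
move=> N0 M0 hx hy; rewrite -(@ler_pXn2r _ 2) ?nnegrE ?mulr_ge0 //.
rewrite real_normK ?num_real // (le_trans (semi_inner_CS x y)) // exprMn.
exact: ler_pM.
Qed.

(** On the complex line through [y], of real dimension two, a real functional with coefficients (a,
    b) vanishes in the direction (b, -a). *)
Lemma rotate_kernel (f : V -> R) (y : V) :
  (forall x y, f (x + y) = f x + f y) -> (forall a x, f (a%:C *: x) = a * f x) ->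
  exists2 c : R[i], Normc.normc c = 1 & f (c *: y) = 0.
Proof.
move=> fD fZ; set a := f y; set b := f ('i *: y).
have h c : f (c *: y) = complex.Re c * a + complex.Im c * b.
  by rewrite scale_complexE fD !fZ.
have [ab|ab] := eqVneq (a ^+ 2 + b ^+ 2) 0.
  exists 1; first by rewrite Normc.normc1.
  move/eqP: ab; rewrite paddr_eq0 ?sqr_ge0 // !sqrf_eq0 => /andP[/eqP a0 /eqP b0].
  by rewrite h a0 b0 !mulr0 addr0.
have m0 : 0 < a ^+ 2 + b ^+ 2 by rewrite lt_neqAle eq_sym ab addr_ge0 ?sqr_ge0.
set m := Num.sqrt (a ^+ 2 + b ^+ 2).
have mp : 0 < m by rewrite sqrtr_gt0.
have mE : m ^+ 2 = a ^+ 2 + b ^+ 2 by rewrite sqr_sqrtr // ltW.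
exists ((b / m) +i* (- a / m)); last by rewrite h /=; ring.
rewrite /= -[RHS]sqrtr1; congr Num.sqrt.
rewrite !exprMn exprVn sqrrN -mulrDl mE addrC divff //.
Qed.

Lemma semi_inner_normalize z : 0 < B z z ->
  exists2 c : R, c ^+ 2 = (B z z)^-1 & B (c%:C *: z) (c%:C *: z) = 1.
Proof.
move=> z0; exists (Num.sqrt (B z z)^-1); first by rewrite sqr_sqrtr // invr_ge0 ltW.
rewrite BZl semi_innerZr mulrA -expr2 sqr_sqrtr ?invr_ge0 ?ltW //.
by rewrite mulVf // gt_eqF.
Qed.

(** * Decreasing the modulus of F *)

Section Improvement.
Variables (T S : {linear V -> V}) (N C : R).
Hypothesis TN : forall x, B (T x) (T x) <= N ^+ 2 * B x x.
Hypothesis TSC : forall x y, B x x = 1 -> B y y = 1 -> `|B (T x) (S y)| <= C.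

(** The vector is [x + s w], normalized, where [w] is a unimodular multiple of [y] and
    [s = r / (24 * C)]; the drop in modulus is [s ^+ 2 * r / 16]. *)
Lemma improve_real x y (r d : R) :
  B x x = 1 -> B y y = 1 -> 0 < r ->
  B (T x) (S x) = r -> B (T x) (S ('i *: x)) = 0 -> B (T y) (S y) <= r / 2 ->
  N ^+ 2 - B (T x) (T x) <= d -> N ^+ 2 - B (T y) (T y) <= d ->
  exists z, [/\ B z z = 1, N ^+ 2 - B (T z) (T z) <= 16 * d &
    B (T z) (S z) ^+ 2 + B (T z) (S ('i *: z)) ^+ 2
      <= (r - r ^+ 3 / (16 * (24 * C) ^+ 2)) ^+ 2].
Proof.
move=> x1 y1 r0 fx fix0 fy xd yd.
pose Fi u v := B (T u) (S ('i *: v)).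
(* The functional is the first order coefficient of Im F along x + s w; a phase of [y] cancels
   it. *)
have [||c c1 fc] := @rotate_kernel (fun w => Fi x w + Fi w x) y.
- move=> u v; rewrite /Fi scalerDr !linearD /= BDl semi_innerDr; ring.
- move=> a u; rewrite /Fi scalerA (mulrC 'i) -scalerA !linearZ /= BZl semi_innerZr; ring.
(* This is the first order coefficient of Re F minus [r] times that of |.|_A^2. It is odd in [w],
   and the other requirements do not see the sign of [w], so [w] or [- w] makes it nonpositive. *)
pose g w := B (T x) (S w) + B (T w) (S x) - 2 * r * B x w.
have [w [w1 wd wF wFi [fw gw]]] : exists w, [/\ B w w = 1,
  N ^+ 2 - B (T w) (T w) <= d, B (T w) (S w) = B (T y) (S y),
  Fi w w = Fi y y & Fi x w + Fi w x = 0 /\ g w <= 0].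
  set w := c *: y.
  have w1 : B w w = 1 by rewrite semi_inner_scale c1 expr1n mul1r.
  have wd : N ^+ 2 - B (T w) (T w) <= d.
    by rewrite linearZ /= semi_inner_scale c1 expr1n mul1r.
  have wF : B (T w) (S w) = B (T y) (S y).
    by rewrite !linearZ /= semi_inner_scale c1 expr1n mul1r.
  have wFi : Fi w w = Fi y y.
    rewrite /Fi scalerA mulrC -scalerA !linearZ /= -!linearZ /=.
    by rewrite !linearZ /= semi_inner_scale c1 expr1n mul1r.
  have [gw|gw] := leP (g w) 0; first by exists w.
  exists (- w); split.
  - by rewrite semi_innerNl semi_innerNr opprK.
  - by rewrite linearN semi_innerNl semi_innerNr opprK.
  - by rewrite !linearN semi_innerNl semi_innerNr opprK.
  - by rewrite /Fi scalerN !linearN semi_innerNl semi_innerNr opprK.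
  split.
    rewrite /Fi scalerN !linearN semi_innerNl semi_innerNr -opprD.
    by move: fc; rewrite -/w /Fi => ->; rewrite oppr0.
  by move: gw; rewrite /g !linearN !semi_innerNl !semi_innerNr; lra.
have iu u : B u u = 1 -> B ('i *: u) ('i *: u) = 1 by rewrite Bii.
have rC : r <= C by rewrite -fx; exact: le_trans (ler_norm _) (TSC x1 x1).
have k2 : `|2 * B x w| <= 2.
  rewrite normrM (ger0_norm (ler0n _ 2)).
  have : `|B x w| <= 1 * 1.
    by apply: semi_inner_norm_le => //; rewrite ?x1 ?w1 expr1n.
  by lra.
have G2 : `|B (T x) (S w) + B (T w) (S x)| <= 2 * C.
  apply: le_trans (ler_normD _ _) _.
  by move: (TSC x1 w1) (TSC w1 x1); lra.
have wr : B (T w) (S w) <= r / 2 by rewrite wF.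
have Gk : B (T x) (S w) + B (T w) (S x) <= r * (2 * B x w).
  by move: gw; rewrite /g; lra.
have [n14 [s1 sq]] := @quadratic_descent R r C (B (T w) (S w)) (Fi w w) _ _
  r0 rC wr (TSC w1 w1) (TSC w1 (iu _ w1)) G2 k2 Gk.
set s := r / (24 * C) in n14 s1 sq.
set n := 1 + s * (2 * B x w) + s ^+ 2 in n14 sq.
set z := x + s%:C *: w.
have C0 : 0 < C by lra.
have s0 : 0 <= s by rewrite /s divr_ge0 ?mulr_ge0 ?ltW.
have zn : B z z = n.
  rewrite /z !(BDl, semi_innerDr, BZl, semi_innerZr) x1 w1 (BC w x) /n; ring.
have zF : B (T z) (S z) = r + s * (B (T x) (S w) + B (T w) (S x)) + s ^+ 2 * B (T w) (S w).
  rewrite /z !(linearD, linearZ) /= !(BDl, semi_innerDr, BZl, semi_innerZr) fx; ring.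
have zFi : B (T z) (S ('i *: z)) = s ^+ 2 * Fi w w.
  have -> : 'i *: z = 'i *: x + s%:C *: ('i *: w).
    by rewrite /z scalerDr !scalerA (mulrC 'i).
  rewrite /z !linearD !linearZ /= !(BDl, semi_innerDr, BZl, semi_innerZr).
  rewrite -!linearZ /= fix0; move: fw; rewrite /Fi => fw.
  apply: (@eq_trans _ _ (s * (B (T x) (S ('i *: w)) + B (T w) (S ('i *: x))) +
    s ^+ 2 * B (T w) (S ('i *: w)))); first by ring.
  by rewrite fw mulr0 add0r.
have np : 0 < n by lra.
have zd : N ^+ 2 * n - B (T z) (T z) <= 4 * d.
  (* parallelogram law for the semidefinite form N^2 |.|^2 - |T .|^2 *)
  have := TN (x - s%:C *: w); rewrite -zn /z.
  rewrite !(linearD, linearN, linearZ) /=.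
  rewrite !(BDl, semi_innerDr, semi_innerNl, semi_innerNr, BZl, semi_innerZr).
  rewrite x1 w1 (BC w x) (BC (T w) (T x)).
  have : s ^+ 2 * (N ^+ 2 - B (T w) (T w)) <= d.
    have : 0 <= N ^+ 2 - B (T w) (T w) by have := TN w; rewrite w1 mulr1 subr_ge0.
    by move=> p0; apply: le_trans wd; rewrite ler_piMl // expr_le1.
  by lra.
have [|e en ez] := @semi_inner_normalize z; first by rewrite zn.
rewrite zn in en.
exists (e%:C *: z); split => //.
  rewrite linearZ /= BZl semi_innerZr mulrA -expr2 en.
  rewrite -(ler_pM2r np) mulrBl (mulrC n^-1) divfK ?gt_eqF //.
  (* As [1 / 4 <= n], dividing the bound [4 * d] by [n] gives at most [16 * d]. *)
  have : 0 <= d by apply: le_trans xd; have := TN x; rewrite x1 mulr1 subr_ge0.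
  by nra.
have -> : 'i *: (e%:C *: z) = e%:C *: ('i *: z) by rewrite !scalerA mulrC.
rewrite !linearZ /= !(BZl, semi_innerZr) -!linearZ /= zF zFi.
have -> : r - r ^+ 3 / (16 * (24 * C) ^+ 2) = r - s ^+ 2 * r / 16.
  by rewrite /s; field; rewrite gt_eqF.
have ee a : e * (e * a) = n^-1 * a by rewrite mulrA -expr2 en.
rewrite !ee ![(n^-1 * _) ^+ 2]exprMn -mulrDr exprVn.
by rewrite ler_pdivrMl ?exprn_gt0 // -exprMn [n * _]mulrC.
Qed.

End Improvement.
End SemiInner.

(** * The infimum of the reachable moduli is zero *)

Section NearZero.
Variables (R : realType) (V : lmodType R[i]) (B : V -> V -> R).
Hypothesis sB : semi_inner B.
Variables (T S : {linear V -> V}) (N C : R).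
Hypothesis TN : forall x, B (T x) (T x) <= N ^+ 2 * B x x.
Hypothesis TSC : forall x y, B x x = 1 -> B y y = 1 -> `|B (T x) (S y)| <= C.

(** This is |F(z)|^2: the second term is the square of the imaginary part. *)
Let sqmod z := B (T z) (S z) ^+ 2 + B (T z) (S ('i *: z)) ^+ 2.

Let inner_scale c z : B (T z) (c *: S z) =
  complex.Re c * B (T z) (S z) + complex.Im c * B (T z) (S ('i *: z)).
Proof.
rewrite (scale_complexE c) (semi_innerDr sB) !(semi_innerZr sB) -linearZ //.
Qed.

Let inner_scalei c z : B (T z) (c *: S ('i *: z)) =
  complex.Re c * B (T z) (S ('i *: z)) - complex.Im c * B (T z) (S z).
Proof.
rewrite (scale_complexE c) (semi_innerDr sB) !(semi_innerZr sB).
rewrite [S ('i *: z)]linearZ /= !scalerA -expr2 sqr_i scaleN1r (semi_innerNr sB).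
by rewrite mulrN.
Qed.

Lemma improve x r d :
  B x x = 1 -> 0 < r -> sqmod x = r ^+ 2 -> N ^+ 2 - B (T x) (T x) <= d ->
  (forall c : R[i], Normc.normc c = 1 -> exists y, [/\ B y y = 1,
    N ^+ 2 - B (T y) (T y) <= d & B (T y) (c *: S y) <= r / 2]) ->
  r <= C /\ exists z, [/\ B z z = 1, N ^+ 2 - B (T z) (T z) <= 16 * d &
    sqmod z <= (r - r ^+ 3 / (16 * (24 * C) ^+ 2)) ^+ 2].
Proof.
move=> x1 r0; rewrite /sqmod; set f := B _ (S x); set g := B _ _ => mx xd dir.
(* This is F(x) / r. Replacing [S] by [c \*: S] multiplies F by the conjugate of [c], so F(x)
   becomes [r] and no modulus changes. *)
pose c := (f / r) +i* (g / r).
have r2 : r != 0 by rewrite gt_eqF.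
have c1' : (f / r) ^+ 2 + (g / r) ^+ 2 = 1.
  by rewrite !exprMn exprVn -mulrDl mx divff // sqrf_eq0.
have c1 : Normc.normc c = 1 by rewrite /= c1' sqrtr1.
have [y [y1 yd yr]] := dir _ c1.
have fx : B (T x) (c *: S x) = r.
  by rewrite inner_scale /= -/f -/g -[RHS](mulfK r2 r) -expr2 -mx; field.
have gx : B (T x) (c *: S ('i *: x)) = 0.
  by rewrite inner_scalei /= -/f -/g; field.
pose S' : {linear V -> V} := c \*: S.
have S'C u v : B u u = 1 -> B v v = 1 -> `|B (T u) (S' v)| <= C.
  move=> u1 v1; rewrite /S' /= -linearZ; apply: TSC => //.
  by rewrite (semi_inner_scale sB) c1 expr1n mul1r.
split.
  by rewrite -fx; apply: le_trans (ler_norm _) (S'C x x x1 x1).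
have [z [z1 zd zm]] := improve_real (S := S') sB TN S'C x1 y1 r0 fx gx yr xd yd.
exists z; split=> //; apply: le_trans zm.
rewrite /S' /= inner_scale inner_scalei /=.
rewrite -[leLHS]mul1r -c1' le_eqVlt; apply/orP; left; apply/eqP; ring.
Qed.

Lemma near_zero :
  0 < C ->
  (forall (c : R[i]) eta d, Normc.normc c = 1 -> 0 < eta -> 0 < d ->
    exists y, [/\ B y y = 1, N ^+ 2 - B (T y) (T y) <= d &
      B (T y) (c *: S y) <= eta]) ->
  forall e d : R, 0 < e -> 0 < d ->
    exists z, [/\ B z z = 1, N ^+ 2 - B (T z) (T z) <= d & sqmod z <= e ^+ 2].
Proof.
move=> C0 dir.
pose X := [set r : R | 0 <= r /\ forall d : R, 0 < d ->
    exists z, [/\ B z z = 1, N ^+ 2 - B (T z) (T z) <= d & sqmod z <= r ^+ 2]].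
(* Both parts of F are at most [C] in modulus on A-unit vectors, so the bound on F imposes nothing
   at [2 * C]. *)
have X2C : X (2 * C).
  split=> [|d d0]; first by rewrite mulr_ge0 // ltW.
  have [|y [y1 yd _]] := dir 1 1 d _ ltr01 d0; first by rewrite Normc.normc1.
  exists y; split=> //.
  have := TSC y1 y1; have := @TSC y ('i *: y) y1; rewrite (semi_innerii sB) => /(_ y1).
  rewrite /sqmod !ler_norml => /andP[a1 a2] /andP[b1 b2]; nra.
have lX : lbound X 0 by move=> r [].
have hX : has_inf X by split; [exists (2 * C) | exists 0].
set i := inf X.
have i0 : 0 <= i by apply: lb_le_inf => //; exists (2 * C).
have i2C : i <= 2 * C by apply: ge_inf X2C; exists 0.
suff i00 : i = 0.
  move=> e d e0 d0; have [r [r0 hr] re] := inf_adherent e0 hX.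
  have [z [z1 zd zm]] := hr d d0; exists z; split=> //.
  apply: le_trans zm _; move: re; rewrite -/i i00 add0r => re.
  by rewrite ler_pXn2r // ?nnegrE ltW.
apply/eqP; rewrite eq_le i0 andbT leNgt; apply/negP => ip.
set D := 16 * (24 * C) ^+ 2.
have D0 : 0 < D by rewrite mulr_gt0 // exprn_gt0 // mulr_gt0.
have CD : 16 * C ^+ 2 <= D by rewrite /D exprMn; nra.
(* A modulus [q > i / 2] drops by at least [q ^+ 3 / D >= 2 * k]; starting below [i + k], it ends
   below [i - k]. *)
set k := i ^+ 3 / (16 * D).
have k0 : 0 < k by rewrite divr_gt0 ?exprn_gt0 // mulr_gt0.
have ki : k <= i / 2.
  rewrite /k ler_pdivrMr ?mulr_gt0 //.
  have : i ^+ 2 <= (2 * C) ^+ 2 by rewrite ler_pXn2r // nnegrE; lra.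
  rewrite exprS; nra.
suff : X (i - k) by move=> Xk; have := ge_inf (ex_intro _ _ lX) Xk; rewrite -/i; lra.
split=> [|d d0]; first by lra.
have [r [r0 hr]] := inf_adherent k0 hX; rewrite -/i => rk.
(* This compensates the factor 16 lost in [improve]. *)
have d16 : 0 < d / 16 by rewrite divr_gt0.
have [x [x1 xd xm]] := hr _ d16.
set q := Num.sqrt (sqmod x).
have sm0 : 0 <= sqmod x by rewrite /sqmod addr_ge0 ?sqr_ge0.
have qE : sqmod x = q ^+ 2 by rewrite sqr_sqrtr.
have q0 : 0 <= q by rewrite sqrtr_ge0.
have qr : q <= r by rewrite -(@ler_pXn2r _ 2) // -qE.
have [qk|qk] := leP q (i - k).
  exists x; split=> //; first by lra.
  by rewrite qE ler_pXn2r // ?nnegrE; lra.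
have qp : 0 < q by lra.
have [|qC [z [z1 zd zm]]] := improve x1 qp qE xd.
  by move=> c c1; apply: dir => //; lra.
exists z; split=> //; first by lra.
apply: le_trans zm _.
have q3 : i ^+ 3 / 8 <= q ^+ 3.
  have -> : i ^+ 3 / 8 = (i / 2) ^+ 3 by field.
  by rewrite ler_pXn2r // ?nnegrE; lra.
rewrite -/D.
have kq : 2 * k <= q ^+ 3 / D.
  rewrite /k ler_pdivlMr //.
  by have -> : 2 * (i ^+ 3 / (16 * D)) * D = i ^+ 3 / 8 by field; rewrite gt_eqF.
(* The lowered modulus stays nonnegative, so comparing squares is legitimate. *)
have kq' : q ^+ 3 / D <= q.
  rewrite ler_pdivrMr //.
  have : q ^+ 2 <= C ^+ 2 by rewrite ler_pXn2r // nnegrE; lra.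
  rewrite exprS; nra.
by rewrite ler_pXn2r // ?nnegrE; lra.
Qed.

End NearZero.

(** * The seminorm of a semidefinite form *)

Section SemiNorm.
Variables (R : rcfType) (V : lmodType R[i]) (B : V -> V -> R).
Hypothesis sB : semi_inner B.
Local Notation norm x := (Num.sqrt (B x x)).

Lemma semi_norm_sqr x : norm x ^+ 2 = B x x.
Proof. by rewrite sqr_sqrtr // (semi_inner_ge0 sB). Qed.

Lemma semi_normZ c x : norm (c *: x) = Normc.normc c * norm x.
Proof.
have c0 : 0 <= Normc.normc c by case: c => a b; exact: sqrtr_ge0.
by rewrite (semi_inner_scale sB) sqrtrM ?sqr_ge0 // sqrtr_sqr ger0_norm.
Qed.

Lemma semi_normD x y : norm (x + y) <= norm x + norm y.
Proof.
have nx := sqrtr_ge0 (B x x); have ny := sqrtr_ge0 (B y y).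
rewrite -(@ler_pXn2r _ 2) ?nnegrE ?addr_ge0 ?sqrtr_ge0 // semi_norm_sqr.
rewrite (semi_innerDl sB) !(semi_innerDr sB) (semi_innerC sB y x).
have : B x y <= norm x * norm y.
  apply: le_trans (ler_norm _) _.
  by apply: (semi_inner_norm_le sB) => //; rewrite semi_norm_sqr.
have := semi_norm_sqr x; have := semi_norm_sqr y; nra.
Qed.

End SemiNorm.

(** * The form of a positive operator *)

Section DotLinearity.
Variables (R : realType) (H : completeNormedModType R[i]).
Variable ip : {dot H for Num.conj}.

Let ipDl x y z : ip (x + y) z = ip x z + ip y z.
Proof. exact: linearDl. Qed.

Let ipZl a x y : ip (a *: x) y = a * ip x y.
Proof. exact: linearZl_LR. Qed.

Let ipDr x y z : ip x (y + z) = ip x y + ip x z.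
Proof. exact: linearDr. Qed.

Let ipir x y : ip x ('i *: y) = - 'i * ip x y.
Proof.
have -> : - 'i = conjc 'i :> R[i] by apply/eqP; rewrite eq_complex /= oppr0 !eqxx.
exact: linearZr_LR.
Qed.

(** Symmetry comes from polarization: <Az, z> is real for z = x, y and x + i y, and the imaginary
    part at x + i y gives Re <Ax, y> = Re <Ay, x>. *)
Lemma semi_inner_ipA (A : {linear H -> H}) :
  positive_operator ip A -> semi_inner (fun x y => complex.Re (ipA ip A x y)).
Proof.
move=> pA; split; rewrite /ipA.
- by move=> x y z /=; rewrite linearD ipDl /=; case: (ip _ _) => ? ?; case: (ip _ _).
- move=> a x y /=; rewrite linearZ /= ipZl; case: (ip _ _) => b c /=.
  by rewrite mul0r subr0.
- move=> x y /=.
  have im0 z : complex.Im (ip (A z) z) = 0 by rewrite ger0_Im // pA.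
  have := im0 (x + 'i *: y); have := im0 x; have := im0 y.
  rewrite [A (_ + _)]linearD [A (_ *: _)]linearZ /= ipDl !ipDr !ipZl !ipir.
  case: (ip (A x) x) => a1 a2; case: (ip (A x) y) => b1 b2.
  case: (ip (A y) x) => c1 c2; case: (ip (A y) y) => d1 d2 /=; lra.
- by move=> x; have := pA x; rewrite lecE /= => /andP[].
- move=> x y /=; rewrite [A (_ *: _)]linearZ /= ipZl ipir mulrA mulrN -expr2 sqr_i.
  by rewrite opprK mul1r.
Qed.

End DotLinearity.

(** * Density of the range and the operator seminorm *)

Section OperatorSeminorm.
Variables (R : realType) (H : completeNormedModType R[i]).
Variables (ip : {dot H for Num.conj}) (A : {linear H -> H}).
Hypothesis hip : hilbert_inner_product ip.
Hypothesis bA : bounded_operator A.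
Hypothesis pA : positive_operator ip A.
Hypothesis A0 : exists x, A x <> 0.

Let E x y := complex.Re (ip x y).
Let B x y := complex.Re (ipA ip A x y).
Let normA := normA ip A.

Let sE : semi_inner E.
Proof.
have h : positive_operator ip idfun.
  by move=> x /=; rewrite -hip exprn_ge0.
exact: semi_inner_ipA h.
Qed.

Let sB : semi_inner B.
Proof. exact: semi_inner_ipA pA. Qed.

Lemma normA_sqr x : normA x ^+ 2 = B x x.
Proof. exact: semi_norm_sqr sB x. Qed.

Lemma normA_ge0 x : 0 <= normA x.
Proof. exact: sqrtr_ge0. Qed.

Lemma normAZ c x : normA (c *: x) = Normc.normc c * normA x.
Proof. exact: semi_normZ sB c x. Qed.

Lemma normAD x y : normA (x + y) <= normA x + normA y.
Proof. exact: semi_normD sB x y. Qed.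

Lemma bounded_operator_sqr : exists2 m : R, 0 < m & forall x, E (A x) (A x) <= m ^+ 2 * E x x.
Proof.
have [r r0 hr] : exists2 r : R[i], 0 < r & forall x, `|A x| <= r * `|x|.
  by move/linear_boundedP : bA => /pinfty_ex_gt0.
have rE : r = (complex.Re r)%:C by rewrite RRe_real // gtr0_real.
exists (complex.Re r) => [|x]; first by move: r0; rewrite ltcE => /andP[].
have : `|A x| ^+ 2 <= r ^+ 2 * `|x| ^+ 2.
  by rewrite -exprMn ler_pXn2r // nnegrE // mulr_ge0 // ltW.
rewrite !hip lecE => /andP[_]; rewrite {1}rE /E -rmorphXn /=.
by case: (ip x x) => a b /=; rewrite mul0r subr0.
Qed.

Lemma range_dense x e : 0 < e -> exists z, B (x - A z) (x - A z) <= e.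
Proof.
move=> e0; have [m m0 hm] := bounded_operator_sqr.
have BE u v : B u v = E (A u) v by [].
(* Cauchy-Schwarz for [B] gives |Au|^4 <= <Au, u> <AAu, Au>, and the last factor is at most m
   |Au|^2. *)
have hq u : E (A u) (A u) <= m * B u u.
  have [E0|Ep] := leP (E (A u) (A u)) 0.
    by rewrite (le_trans E0) // mulr_ge0 ?(semi_inner_ge0 sB) // ltW.
  have h1 : E (A u) (A u) ^+ 2 <= B u u * B (A u) (A u) by rewrite -BE (semi_inner_CS sB).
  have h2 : B (A u) (A u) <= m * E (A u) (A u).
    rewrite -(@ler_pXn2r _ 2) ?nnegrE ?(semi_inner_ge0 sB) //; last by rewrite mulr_ge0 ?ltW.
    rewrite BE (le_trans (semi_inner_CS sE _ _)) // exprMn [E _ _ ^+ 2]expr2 mulrA.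
    by rewrite ler_pM2r.
  rewrite -(ler_pM2r Ep) -expr2 (le_trans h1) // -mulrA mulrCA.
  by rewrite ler_wpM2l ?(semi_inner_ge0 sB).
apply: contrapT => /forallNP hN.
have dec n : exists z, E (x - A z) (x - A z) <= E x x - n%:R * (e / m).
  elim: n => [|n [z hz]]; first by exists 0; rewrite linear0 subr0 mul0r subr0.
  set u := x - A z in hz.
  (* Expanding, |u - m^-1 Au|^2 = |u|^2 - 2 m^-1 <Au, u> + m^-2 |Au|^2, and [hq] bounds the last
     term by m^-1 <Au, u>. *)
  exists (z + (m^-1)%:C *: u).
  have -> : x - A (z + (m^-1)%:C *: u) = u - (m^-1)%:C *: A u.
    by rewrite linearD linearZ /= opprD addrA.
  have hu : e < B u u by rewrite ltNge; exact/negP/hN.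
  clearbody u.
  rewrite !(semi_innerDl sE, semi_innerDr sE, semi_innerNl sE, semi_innerNr sE,
    semi_innerZl sE, semi_innerZr sE) (semi_innerC sE u (A u)) -BE.
  have h1 : m^-1 * (m^-1 * E (A u) (A u)) <= m^-1 * B u u.
    by rewrite ler_pM2l ?invr_gt0 // ler_pdivrMl.
  have h2 : e / m <= m^-1 * B u u.
    by rewrite mulrC ler_pM2l ?invr_gt0 // ltW.
  rewrite -natr1; lra.
pose n := Num.bound (E x x / (e / m)).
have [z] := dec n.+1; apply/negP; rewrite -ltNge.
apply: lt_le_trans (semi_inner_ge0 sE _); rewrite subr_lt0.
rewrite -ltr_pdivrMr ?divr_gt0 //.
apply: lt_le_trans (archi_boundP _) _; last by rewrite ler_nat.
by apply: divr_ge0; [exact: (semi_inner_ge0 sE) | apply: divr_ge0; exact: ltW].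
Qed.

(** If [B] vanished on the diagonal, Cauchy-Schwarz would give |Ax|^2 = B(x, Ax) = 0 for all x. *)
Lemma normA_unit_exists : exists u, normA u = 1.
Proof.
suff [u u0] : exists u, 0 < B u u.
  have [c c2 cu] := semi_inner_normalize sB u0.
  by exists (c%:C *: u); rewrite /normA /Defs.normA -/(B _ _) cu sqrtr1.
apply: contrapT => /forallNP h.
have B0 u : B u u = 0.
  by apply/eqP; rewrite eq_le (semi_inner_ge0 sB) andbT leNgt; exact/negP/h.
have [x Ax] := A0; apply: Ax.
have := semi_inner_CS sB x (A x); rewrite !B0 mulr0 => h1.
have e0 : E (A x) (A x) = 0 by apply/eqP; rewrite -sqrf_eq0 eq_le h1 sqr_ge0.
apply/eqP; rewrite -normr_eq0 -sqrf_eq0 hip eq_complex -/(E _ _) e0 eqxx /=.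
by apply/eqP/ger0_Im; rewrite -hip exprn_ge0.
Qed.

Section BoundedMap.
Variables (U : {linear H -> H}) (c : R).
Hypothesis c0 : 0 < c.
Hypothesis Uc : forall x, normA (U x) <= c * normA x.

Let ratios := [set normA (U x) / normA x | x in closure (range A) `\ (0 : H)].

Let has_sup_ratios : has_sup ratios.
Proof.
have [x Ax] := A0; split.
  exists (normA (U (A x)) / normA (A x)); exists (A x) => //; split => //.
  by apply: subset_closure; exists x.
exists c => _ [y _ <-].
(* Division by zero gives 0, so a vector of zero A-seminorm contributes the ratio 0. *)
have [->|y0] := eqVneq (normA y) 0; first by rewrite invr0 mulr0 ltW.
by rewrite ler_pdivrMr // lt_neqAle eq_sym y0 normA_ge0.
Qed.

Lemma opnormA_ge0 : 0 <= opnormA ip A U.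
Proof.
have [[r rX] _] := has_sup_ratios.
apply: le_trans (ub_le_sup (has_sup_ratios).2 rX).
by case: rX => y _ <-; rewrite divr_ge0 // normA_ge0.
Qed.

(** On the range of [A] the supremum gives the bound, and [Uc] settles vectors of zero A-seminorm; a
    point of the range within [d] of [x] then costs an error [(N + c) * d]. *)
Lemma normA_le_opnormA x : normA (U x) <= opnormA ip A U * normA x.
Proof.
have N0 := opnormA_ge0; set N := opnormA ip A U in N0 *.
have hz z : normA (U (A z)) <= N * normA (A z).
  have [->|z0] := eqVneq (A z) 0.
    by rewrite linear0 -(scale0r 0) normAZ Normc.normc0 mul0r mulr0.
  have [n0|n0] := eqVneq (normA (A z)) 0.
    by rewrite (le_trans (Uc _)) // n0 !mulr0.
  rewrite -ler_pdivrMr; last by rewrite lt_neqAle eq_sym n0 normA_ge0.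
  apply: (ub_le_sup (has_sup_ratios).2); exists (A z) => //; split.
    by apply: subset_closure; exists z.
  exact/eqP.
have key d : 0 < d -> normA (U x) <= N * normA x + (N + c) * d.
  move=> d0; have [z hd] := range_dense x (exprn_gt0 2 d0).
  set u := x - A z in hd.
  have ud : normA u <= d.
    rewrite -(@ler_pXn2r _ 2) ?nnegrE ?normA_ge0 ?(ltW d0) // normA_sqr.
    exact: hd.
  have h1 : normA (U x) <= normA (U (A z)) + normA (U u).
    have -> : U x = U (A z) + U u by rewrite -linearD addrC subrK.
    exact: normAD.
  have h2 : normA (A z) <= normA x + normA u.
    have -> : A z = x + (-1) *: u by rewrite scaleN1r /u opprB addrC subrK.
    apply: le_trans (normAD _ _) _; rewrite lerD2l.
    rewrite normAZ (_ : Normc.normc _ = 1) ?mul1r //.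
    by rewrite /= oppr0 expr0n addr0 sqrrN expr1n sqrtr1.
  have := ler_wpM2l N0 h2; have := ler_wpM2l N0 ud; have := ler_wpM2l (ltW c0) ud.
  by have := hz z; have := Uc u; lra.
apply/ler_addgt0Pr => e e0.
have Nc : 0 < N + c by rewrite ltr_wpDl.
have := key (e / (N + c)); rewrite divr_gt0 // => /(_ isT).
by rewrite (mulrCA (N + c)) divff ?gt_eqF // mulr1.
Qed.

Lemma opnormA_approx e : 0 < e ->
  exists y, normA y = 1 /\ opnormA ip A U ^+ 2 - B (U y) (U y) <= e.
Proof.
have N0 := opnormA_ge0; set N := opnormA ip A U in N0 *.
(* N^2 - |Uy|_A^2 factors with second factor at most 2 N; the 1 keeps the denominator positive. *)
move=> e0; pose d := e / (2 * N + 1).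
have N1 : 0 < 2 * N + 1 by lra.
have d0 : 0 < d by rewrite divr_gt0.
suff [y [y1 yd]] : exists y, normA y = 1 /\ N - d <= normA (U y).
  exists y; split=> //.
  have := normA_le_opnormA y; rewrite -/N y1 mulr1 => yN.
  rewrite -normA_sqr.
  have de : d * (2 * N + 1) = e by rewrite divfK ?gt_eqF.
  have : 0 <= normA (U y) by exact: normA_ge0.
  nra.
have [r [y [_ y0] <-] hr] := sup_adherent d0 has_sup_ratios.
(* Here the ratio is 0 by convention, so [N - d] is negative and any A-unit vector serves. *)
have [n0|n0] := eqVneq (normA y) 0.
  have [u u1] := normA_unit_exists; exists u; split=> //.
  move: hr; rewrite n0 invr0 mulr0 => /ltW /le_trans; apply; exact: normA_ge0.
exists ((normA y)^-1%:C *: y).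
have ny : 0 <= normA y by exact: normA_ge0.
have nc : Normc.normc ((normA y)^-1)%:C = (normA y)^-1.
  by rewrite /= expr0n addr0 sqrtr_sqr ger0_norm ?invr_ge0.
by rewrite [U _]linearZ !normAZ nc mulVf //; split=> //; rewrite mulrC ltW.
Qed.

End BoundedMap.
End OperatorSeminorm.

(** * Convergence to zero through real moduli *)

Lemma cvg_complex0P (R : realType) (f : nat -> R[i]) :
  (f n @[n --> \oo] --> (0 : (R[i] : numFieldType))) <->
  (forall e : R, 0 < e -> \forall n \near \oo, Normc.normc (f n) < e).
Proof.
have normcE (z : R[i]) : `|0 - z| = (Normc.normc z)%:C.
  by rewrite sub0r normrN normc_def; case: z.
split=> [/(@cvgrPdist_lt _ (R[i] : numFieldType)) f0 e e0 | f0].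
  have eC : 0 < e%:C :> R[i] by rewrite ltcR.
  apply: filterS (f0 _ eC) => n.
  by rewrite -ltcR -normcE.
apply/(@cvgrPdist_lt _ (R[i] : numFieldType)) => e e0.
have eE : e = (complex.Re e)%:C by rewrite RRe_real // gtr0_real.
have e0' : 0 < complex.Re e by move: e0; rewrite ltcE => /andP[].
apply: filterS (f0 _ e0') => n.
by rewrite -ltcR -eE -normcE.
Qed.

(** * The three implications *)

Section BirkhoffOrthogonality.
Variables (R : realType) (H : completeNormedModType R[i]).
Variables (ip : {dot H for Num.conj}) (A : {linear H -> H}).
Hypothesis hip : hilbert_inner_product ip.
Hypothesis bA : bounded_operator A.
Hypothesis pA : positive_operator ip A.
Hypothesis A0 : exists x, A x <> 0.
Variables T S : {linear H -> H}.
Hypothesis hT : A_bounded ip A T.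
Hypothesis hS : A_bounded ip A S.

Let B x y := complex.Re (ipA ip A x y).
Let normA := normA ip A.
Let N := opnormA ip A T.
Let sqmod x := B (T x) (S x) ^+ 2 + B (T x) (S ('i *: x)) ^+ 2.

Let sB : semi_inner B.
Proof. exact: semi_inner_ipA pA. Qed.

Let nsq x : normA x ^+ 2 = B x x.
Proof. exact: normA_sqr pA x. Qed.

Lemma Im_ipA x y : complex.Im (ipA ip A x y) = B x ('i *: y).
Proof.
have -> : B x ('i *: y) = - B ('i *: x) y by rewrite (semi_inneril sB) opprK.
have -> : B ('i *: x) y = complex.Re ('i * ipA ip A x y).
  rewrite /B /ipA [A (_ *: _)]linearZ /=; congr complex.Re; exact: linearZl_LR.
by case: (ipA ip A x y) => a b /=; rewrite mul0r mul1r sub0r opprK.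
Qed.

Lemma sqr_normc_ipA x : Normc.normc (ipA ip A (T x) (S x)) ^+ 2 = sqmod x.
Proof.
rewrite /sqmod linearZ /= -Im_ipA /B; case: (ipA _ _ _ _) => a b /=.
by rewrite sqr_sqrtr // addr_ge0 ?sqr_ge0.
Qed.

Lemma A_bounded_pencil g :
  exists2 c : R, 0 < c & forall x, normA ((T \+ g \*: S) x) <= c * normA x.
Proof.
have [_ [c c0 hc]] := hT; have [_ [d d0 hd]] := hS.
have g0 : 0 <= Normc.normc g by case: g => a b; exact: sqrtr_ge0.
exists (c + Normc.normc g * d) => [|x]; first by rewrite ltr_wpDr // mulr_ge0 // ltW.
apply: le_trans (normAD pA _ _) _; rewrite mulrDl lerD //.
rewrite (normAZ pA) -mulrA; apply: ler_wpM2l => //; exact: hd.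
Qed.

Lemma opnormA_pencil_sqr g x : normA x = 1 ->
  B (T x) (T x) + 2 * B (T x) (g *: S x) + Normc.normc g ^+ 2 * B (S x) (S x)
    <= opnormA ip A (T \+ g \*: S) ^+ 2.
Proof.
move=> x1; have [c c0 hc] := A_bounded_pencil g.
have := normA_le_opnormA hip bA pA A0 c0 hc x.
rewrite -/normA x1 mulr1 => h.
have -> : B (T x) (T x) + 2 * B (T x) (g *: S x) + Normc.normc g ^+ 2 * B (S x) (S x)
    = normA ((T \+ g \*: S) x) ^+ 2.
  rewrite nsq /= -(semi_inner_scale sB).
  rewrite (semi_innerDl sB) !(semi_innerDr sB) (semi_innerC sB (g *: S x)).
  ring.
by rewrite ler_pXn2r // ?nnegrE ?normA_ge0 // (opnormA_ge0 A0 c0 hc).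
Qed.

(** Condition (i) without sequences; the gap to the seminorm is measured on squares, as the form
    p. *)
Definition approx_orthogonal := forall e : R, 0 < e -> exists x,
  [/\ normA x = 1, N ^+ 2 - B (T x) (T x) <= e & sqmod x <= e ^+ 2].

Let N0 : 0 <= N.
Proof. by have [_ [c c0 hc]] := hT; exact: (opnormA_ge0 A0 c0 hc). Qed.

Let TN x : normA (T x) <= N * normA x.
Proof. by have [_ [c c0 hc]] := hT; exact: (normA_le_opnormA hip bA pA A0 c0 hc). Qed.

Let norm1 x : normA x = 1 -> B x x = 1.
Proof. by move=> x1; rewrite -nsq x1 expr1n. Qed.

Lemma approx_orthogonal_minmod : approx_orthogonal ->
  forall g, N ^+ 2 + Normc.normc g ^+ 2 * minmodA ip A S ^+ 2
    <= opnormA ip A (T \+ g \*: S) ^+ 2.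
Proof.
move=> apx g; set L := opnormA _ _ _; set m := minmodA _ _ _.
have g0 : 0 <= Normc.normc g by case: g {L} => a b; exact: sqrtr_ge0.
have m0 : 0 <= m.
  apply: lb_le_inf => [|_ [x _ <-]]; last exact: normA_ge0.
  have [u u1] := normA_unit_exists hip pA A0.
  by exists (normA (S u)); exists u.
apply/ler_addgt0Pr => e e0.
(* The gap of [T] costs [d] and the cross term costs 2 |g| d. *)
pose d := e / (1 + 2 * Normc.normc g).
have g1 : 0 < 1 + 2 * Normc.normc g by lra.
have [|x [x1 xd xm]] := apx d; first by rewrite divr_gt0.
have := opnormA_pencil_sqr g x1; rewrite -/L.
have mS : m ^+ 2 <= B (S x) (S x).
  rewrite -nsq ler_pXn2r // ?nnegrE ?normA_ge0 //.
  apply: ge_inf; last by exists x.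
  by exists 0 => _ [y _ <-]; exact: normA_ge0.
have := ler_wpM2l (sqr_ge0 (Normc.normc g)) mS.
have : `|B (T x) (g *: S x)| <= Normc.normc g * d.
  have d0 : 0 <= d by rewrite divr_ge0 // ltW.
  rewrite -(@ler_pXn2r _ 2) ?nnegrE ?(mulr_ge0 g0 d0) ?normr_ge0 // real_normK ?num_real //.
  rewrite exprMn; apply: le_trans (_ : _ <= Normc.normc g ^+ 2 * sqmod x) _; last first.
    by apply: ler_wpM2l => //; exact: sqr_ge0.
  rewrite (scale_complexE g) (semi_innerDr sB) !(semi_innerZr sB) -['i *: S x]linearZ /sqmod /=.
  case: (g) => a b /=; rewrite sqr_sqrtr ?addr_ge0 ?sqr_ge0 //.
  (* Lagrange's identity in the plane. *)
  set u := B _ _; set v := B _ _; have := sqr_ge0 (a * v - b * u); lra.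
rewrite ler_norml => /andP[h1 h2].
have : d + 2 * (Normc.normc g * d) = e by rewrite mulrA -{1}(mul1r d) -mulrDl mulrC divfK ?gt_eqF.
lra.
Qed.

Lemma minmod_birkhoff :
  (forall g, N ^+ 2 + Normc.normc g ^+ 2 * minmodA ip A S ^+ 2
    <= opnormA ip A (T \+ g \*: S) ^+ 2) ->
  birkhoff_orthogonalA ip A T S.
Proof.
move=> h g; have [c c0 hc] := A_bounded_pencil g.
rewrite -(@ler_pXn2r _ 2) ?nnegrE ?(opnormA_ge0 A0 c0 hc) //.
apply: le_trans (h g); rewrite lerDl mulr_ge0 ?sqr_ge0 //.
Qed.

Lemma birkhoff_approx_orthogonal :
  birkhoff_orthogonalA ip A T S -> approx_orthogonal.
Proof.
move=> bo; have [_ [s s0 hs]] := hS.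
set M := opnormA ip A S.
have M0 : 0 <= M by exact: (opnormA_ge0 A0 s0 hs).
have SM x : normA (S x) <= M * normA x by exact: (normA_le_opnormA hip bA pA A0 s0 hs).
have TN2 x : B (T x) (T x) <= N ^+ 2 * B x x.
  by rewrite -!nsq -exprMn ler_pXn2r ?nnegrE ?mulr_ge0 ?normA_ge0 ?TN.
have SM2 x : B (S x) (S x) <= M ^+ 2 * B x x.
  by rewrite -!nsq -exprMn ler_pXn2r ?nnegrE ?mulr_ge0 ?normA_ge0 ?SM.
(* The 1 makes [C] positive even if [N * M = 0]. *)
pose C := N * M + 1.
have NM : 0 <= N * M by rewrite mulr_ge0.
have TSC x y : B x x = 1 -> B y y = 1 -> `|B (T x) (S y)| <= C.
  move=> x1 y1; apply: (@le_trans _ _ (N * M)); last by rewrite /C; lra.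
  apply: (semi_inner_norm_le sB) => //.
    by have := TN2 x; rewrite x1 mulr1.
  by have := SM2 y; rewrite y1 mulr1.
have C0 : 0 < C by rewrite /C; lra.
have dir (c : R[i]) (eta d : R) : Normc.normc c = 1 -> 0 < eta -> 0 < d ->
    exists y, [/\ B y y = 1, N ^+ 2 - B (T y) (T y) <= d & B (T y) (c *: S y) <= eta].
  move=> c1 eta0 d0.
  pose D := 1 + M ^+ 2 + 2 * C.
  have D0 : 0 < D by rewrite /D; have := sqr_ge0 M; lra.
  pose t := Num.min 1 (Num.min d eta / D).
  have t0 : 0 < t by rewrite lt_min ltr01 divr_gt0 // lt_min d0.
  have t1 : t <= 1 by rewrite ge_min lexx.
  have tD : t * D <= Num.min d eta by rewrite -ler_pdivlMr // /t ge_min lexx orbT.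
  have td : t * D <= d by apply: le_trans tD _; rewrite ge_min lexx.
  have te : t * D <= eta by apply: le_trans tD _; rewrite ge_min lexx orbT.
  set g := (- t)%:C * c.
  have [k k0 hk] := A_bounded_pencil g.
  (* The precision t^2 matches the second order term. With (iii) it yields p(y) + 2 t b <= t^2 (1 +
     M^2). As p(y) >= 0, dividing by t bounds b; as [b >= - C], p(y) is at most [t * D]. *)
  have [y [y1 hy]] := opnormA_approx hip bA pA A0 k0 hk (exprn_gt0 2 t0).
  have yy := norm1 y1.
  exists y.
  set b := B (T y) (c *: S y).
  have hU : B ((T \+ g \*: S) y) ((T \+ g \*: S) y) =
      B (T y) (T y) - 2 * t * b + t ^+ 2 * B (S y) (S y).
    rewrite /= /g -scalerA (semi_innerDl sB) !(semi_innerDr sB).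
    rewrite !(semi_innerZl sB) !(semi_innerZr sB) (semi_inner_scale sB) c1.
    rewrite (semi_innerC sB (c *: S y)) -/b; ring.
  have LN : N ^+ 2 <= opnormA ip A (T \+ g \*: S) ^+ 2.
    by rewrite ler_pXn2r ?nnegrE ?(opnormA_ge0 A0 k0 hk) //; exact: bo.
  have h : N ^+ 2 - (B (T y) (T y) - 2 * t * b + t ^+ 2 * B (S y) (S y)) <= t ^+ 2.
    by rewrite -hU; apply: le_trans hy; rewrite lerB.
  have bC : `|b| <= C.
    rewrite /b -linearZ; apply: TSC => //.
    by rewrite (semi_inner_scale sB) c1 expr1n mul1r.
  move: bC; rewrite ler_norml => /andP[b1 b2].
  have := SM2 y; rewrite yy mulr1 => Sy.
  have := TN2 y; rewrite yy mulr1 => Ty.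
  have tS : t ^+ 2 * B (S y) (S y) <= t ^+ 2 * M ^+ 2 by rewrite ler_wpM2l ?sqr_ge0.
  have tt : t ^+ 2 <= t by nra.
  split=> //.
    have h1 : t ^+ 2 * M ^+ 2 <= t * M ^+ 2 by rewrite ler_wpM2r ?sqr_ge0.
    have h2 : t * - b <= t * C by rewrite ler_pM2l //; lra.
    by apply: le_trans td; rewrite /D; lra.
  have h1 : t * (2 * b) <= t * (t * (1 + M ^+ 2)) by lra.
  move: h1; rewrite ler_pM2l // => h1.
  have h2 : 0 <= t * C by rewrite mulr_ge0 ?ltW.
  have h3 : 0 <= t * (1 + M ^+ 2) by rewrite mulr_ge0 ?addr_ge0 ?sqr_ge0 ?ltW.
  by move: te; rewrite /D; lra.
move=> e e0; have [x [x1 xd xm]] := near_zero sB TN2 TSC C0 dir e0 e0.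
by exists x; split=> //; rewrite /normA /Defs.normA -/(B _ _) x1 sqrtr1.
Qed.

Lemma approx_orthogonalP : approx_orthogonal <->
  exists x : nat -> H,
    [/\ forall n, normA (x n) = 1,
        (normA (T (x n)) @[n --> \oo] --> N)
      & (ipA ip A (T (x n)) (S (x n)) @[n --> \oo] --> (0 : (R[i] : numFieldType)))].
Proof.
have normc_ge0 (z : R[i]) : 0 <= Normc.normc z by case: z => ? ?; exact: sqrtr_ge0.
split=> [apx | [x [x1 xT xTS]] e e0].
  pose e n : R := n.+1%:R^-1.
  have e_gt0 n : 0 < e n by rewrite invr_gt0.
  have e_le1 n : e n <= 1 by rewrite invf_le1 // ler1n.
  (* The precision is squared because (N - a)^2 <= N^2 - a^2 for 0 <= a <= N. *)
  have /choice[x hx] : forall n, exists x, [/\ normA x = 1,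
      N ^+ 2 - B (T x) (T x) <= e n ^+ 2 & sqmod x <= e n ^+ 2].
    move=> n; have [x [x1 xd xm]] := apx _ (exprn_gt0 2 (e_gt0 n)).
    exists x; split=> //; apply: le_trans xm _.
    by rewrite [leLHS]expr2 ler_piMl ?sqr_ge0 // expr_le1 ?e_le1 ?(ltW (e_gt0 n)).
  exists x; split=> [n||]; first by have [] := hx n.
    apply/cvgrPdist_lt => r r0; near=> n.
    have [x1 xd _] := hx n.
    apply: le_lt_trans (_ : e n < r); last by near: n; exact: (near_infty_natSinv_lt (PosNum r0)).
    have := TN (x n); rewrite x1 mulr1 => TxN.
    rewrite ger0_norm ?subr_ge0 // -(@ler_pXn2r _ 2) ?nnegrE ?subr_ge0 ?(ltW (e_gt0 n)) //.
    apply: le_trans xd; rewrite -nsq.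
    have : 0 <= normA (T (x n)) by exact: normA_ge0.
    nra.
  apply/cvg_complex0P => r r0; near=> n.
  have [_ _ xm] := hx n.
  apply: le_lt_trans (_ : e n < _).
    by rewrite -(@ler_pXn2r _ 2) ?nnegrE ?normc_ge0 ?(ltW (e_gt0 n)) // sqr_normc_ipA.
  by near: n; exact: (near_infty_natSinv_lt (PosNum r0)).
have d0 : 0 < e / (2 * N + 1) by rewrite divr_gt0 // ltr_wpDl // mulr_ge0.
move/cvgrPdist_lt : xT => /(_ _ d0) xT.
move/cvg_complex0P : xTS => /(_ _ e0) xTS.
have [n [h1 h2]] := filter_ex (filterI xT xTS).
exists (x n); split=> //.
  have := TN (x n); rewrite x1 mulr1 => TxN.
  move: h1; rewrite ger0_norm ?subr_ge0 // => h1.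
  rewrite -nsq.
  have de : (e / (2 * N + 1)) * (2 * N + 1) = e.
    by rewrite divfK // gt_eqF // ltr_wpDl // mulr_ge0.
  have : 0 <= normA (T (x n)) by exact: normA_ge0.
  move: h1 de d0; set d := e / _ => h1 de d0 a0.
  have : (N - normA (T (x n))) * (N + normA (T (x n))) <= d * (2 * N).
    by apply: ler_pM; lra.
  lra.
by rewrite -sqr_normc_ipA ler_pXn2r ?nnegrE ?normc_ge0 ?(ltW e0) ?(ltW h2).
Unshelve. all: by end_near. Qed.

End BirkhoffOrthogonality.

(** [A0] excludes A = 0, where no A-unit vector exists: (i) fails, while (ii) and (iii) reduce to 0
    <= 0. *)
Theorem theorem2p2 (R : realType) (H : completeNormedModType R[i])
    (ip : {dot H for Num.conj}) (hip : hilbert_inner_product ip)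
    (A : {linear H -> H}) (bA : bounded_operator A)
    (pA : positive_operator ip A) (A0 : exists x, A x <> 0)
    (T S : {linear H -> H}) (hT : A_bounded ip A T) (hS : A_bounded ip A S) :
  [<-> exists x : nat -> H,
         [/\ forall n, normA ip A (x n) = 1,
             (normA ip A (T (x n)) @[n --> \oo] --> opnormA ip A T)
           & (ipA ip A (T (x n)) (S (x n)) @[n --> \oo] --> (0 : (R[i] : numFieldType)))];
       forall g : R[i],
         opnormA ip A T ^+ 2 + Normc.normc g ^+ 2 * minmodA ip A S ^+ 2
           <= opnormA ip A (T \+ g \*: S) ^+ 2;
       birkhoff_orthogonalA ip A T S].
Proof.
have apxP := approx_orthogonalP hip bA pA A0 S hT.
tfae.
- by move=> /apxP; exact: approx_orthogonal_minmod.
- exact: minmod_birkhoff.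
- by move=> bo; apply/apxP; exact: birkhoff_approx_orthogonal.
Qed.
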